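(* $\mathcal{P}_{4,4}^{s0}\subset\Sigma_{4,4}$, and $\mathcal{E}(\mathcal{P}_{4,4}^{s0})\cap\mathcal{E}(\mathcal{P}_{4,4})=\emptyset$.
   Context: $\mathcal{P}_{4,4}$ is the cone of real quartic forms in four variables that are nonnegative on $\mathbb{R}^4$. $\mathcal{P}_{4,4}^{s0}$ is the subcone of those $f\in\mathcal{P}_{4,4}$ that are symmetric (invariant under all permutations of the variables) and satisfy $f(1,1,1,1)=0$. $\Sigma_{4,4}$ is the set of quartic forms in four variables that are finite sums $g_1^2+\cdots+g_r^2$ of squares of real quadratic forms $g_i$. For a cone $\mathcal{P}$, $\mathcal{E}(\mathcal{P})$ is the set of its extremal elements: $0\ne f\in\mathcal{P}$ such that $f=g+h$ with $g,h\in\mathcal{P}$ implies that $g$ and $h$ are scalar multiples of $f$. *)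

(* Defs.v *)
From mathcomp Require Import all_boot all_order all_algebra.
From mathcomp Require Import classical_sets reals.
From mathcomp Require Import mpoly.

Set Implicit Arguments.
Unset Strict Implicit.
Unset Printing Implicit Defensive.

Import Order.TTheory GRing.Theory Num.Theory.
Local Open Scope classical_set_scope.
Local Open Scope ring_scope.

(* Forms are formal polynomials; the zero polynomial is homogeneous of every
   degree, so it belongs to each of the cones below. *)

Definition P44 (R : realType) : set {mpoly R[4]} :=
  [set f | f \is 4.-homog /\ forall x : 'I_4 -> R, 0 <= f.@[x]].

Definition P44s0 (R : realType) : set {mpoly R[4]} :=
  [set f | [/\ P44 f, f \is symmetric & f.@[fun=> 1] = 0]].

Definition Sigma44 (R : realType) : set {mpoly R[4]} :=
  [set f | exists r (g : 'I_r -> {mpoly R[4]}),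
    (forall i, g i \is 2.-homog) /\ f = \sum_(i < r) g i ^+ 2].

Definition extremal (R : realType) (V : lmodType R) (C : set V) : set V :=
  [set f | [/\ C f, f != 0 & forall g h, C g -> C h -> f = g + h ->
    (exists a : R, g = a *: f) /\ (exists b : R, h = b *: f)]].

(* Main.v *)
Require Import Defs.
From mathcomp Require Import all_boot all_order all_algebra.
From mathcomp Require Import classical_sets reals.
From mathcomp Require Import mpoly.
From mathcomp Require Import zify ring lra.

Set Implicit Arguments.
Unset Strict Implicit.
Unset Printing Implicit Defensive.

Import Order.TTheory GRing.Theory Num.Theory.
Local Open Scope classical_set_scope.
Local Open Scope ring_scope.

(** Symmetric quartic forms with a zero at (1,1,1,1) become transparent in the
    coordinates
      t = x0+x1+x2+x3,  u = x0+x1-x2-x3,  v = x0-x1+x2-x3,  w = x0-x1-x2+x3,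
    on which the permutations of the x_i act by permuting u, v, w and changing
    an even number of their signs. Invariance kills all terms but five, and the
    zero kills t^4, so that such a form is
      f = a t^2 (u^2+v^2+w^2) + b tuvw + e (u^2 v^2 + u^2 w^2 + v^2 w^2)
          + c ((v^2-w^2)^2 + (u^2-w^2)^2 + (u^2-v^2)^2)
    (lemma [symmetric_quartic_coordinates]). If f is nonnegative, its value at
    (0,1,0,0) gives c >= 0, and its values on the line u = v = w = 1 say that the
    quadratic a t^2 + (b/3) t + e is nonnegative, hence that the binary form
    q(X,Y) = a X^2 + (b/3) XY + e Y^2 is a sum of two squares. But
      f = (q(tu,vw) + c (v^2-w^2)^2) + (q(tv,uw) + c (u^2-w^2)^2)
          + (q(tw,uv) + c (u^2-v^2)^2),
    so f is a sum of squares: three [block]s, one for each of u, v, w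
    ([P44s0_blocks]).

    The same decomposition shows that no nonzero f in the symmetric cone is
    extremal among all nonnegative quartics, which is more than the required
    disjointness. Each block is a nonnegative quartic, so if f were extremal
    the first block would be a multiple of f; as f is symmetric in u, v, w, the
    first block would then be unchanged when u and v are exchanged. Comparing
    values at three points forces every coefficient of the block to vanish, and
    f = 0 ([P44s0_not_extremal]). *)

(** * Symmetric quartic forms *)

Local Notation i0 := (@Ordinal 4 0 isT).
Local Notation i1 := (@Ordinal 4 1 isT).
Local Notation i2 := (@Ordinal 4 2 isT).
Local Notation i3 := (@Ordinal 4 3 isT).

(** The elementary symmetric polynomials in the nested shape that the recursion
    e_k(x_0,..,x_n) = e_k(x_0,..,x_(n-1)) + e_(k-1)(x_0,..,x_(n-1)) x_n
    produces. *)
Lemma mesym4E (R : comNzRingType) :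
  let x0 := 'X_i0 : {mpoly R[4]} in let x1 := 'X_i1 in
  let x2 := 'X_i2 in let x3 := 'X_i3 in
  [/\ mesym 4 R 1 = x0 + x1 + x2 + x3,
      mesym 4 R 2 = x0 * x1 + (x0 + x1) * x2 + (x0 + x1 + x2) * x3,
      mesym 4 R 3 = x0 * x1 * x2 + (x0 * x1 + (x0 + x1) * x2) * x3
    & mesym 4 R 4 = x0 * x1 * x2 * x3].
Proof.
have w n (i : 'I_n) :
    mwiden ('X_i : {mpoly R[n]}) = 'X_(widen_ord (leqnSn n) i).
  by rewrite mwidenX mnmwiden1.
have X (i j : 'I_4) : val i = val j -> 'X_i = 'X_j :> {mpoly R[4]}.
  by move/val_inj->.
have e32 : mesym 3 R 2 = 'X_(inord 0) * 'X_(inord 1)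
                         + ('X_(inord 0) + 'X_(inord 1)) * 'X_(inord 2).
  rewrite (mesymSS R 2 1) mesymnnE mesym1E !big_ord_recr !big_ord0 /=.
  rewrite mul1r add0r mwidenM mwidenD !w.
  by congr ('X_ _ * 'X_ _ + ('X_ _ + 'X_ _) * 'X_ _);
    apply: val_inj; rewrite /= inordK.
split.
- rewrite mesym1E !big_ord_recr big_ord0 /= add0r.
  by congr (_ + _ + _ + _); apply: X.
- rewrite mesymSS e32 mesym1E !big_ord_recr !big_ord0 /= add0r.
  rewrite !(mwidenD, mwidenM, w).
  by congr (_ * _ + (_ + _) * _ + (_ + _ + _) * _); apply: X; rewrite /= ?inordK.
- rewrite mesymSS e32 mesymnnE !big_ord_recr !big_ord0 /= mul1r.
  rewrite !(mwidenD, mwidenM, w).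
  by congr (_ * _ * _ + (_ * _ + (_ + _) * _) * _); apply: X; rewrite /= ?inordK.
- rewrite mesymnnE !big_ord_recr big_ord0 /= mul1r.
  by congr (_ * _ * _ * _); apply: X.
Qed.

Local Notation es k := (mesym 4 _ k%N).

(** By the fundamental theorem of symmetric polynomials, f is a polynomial in
    e_1,..,e_4 that is homogeneous of weight 4 when e_k has weight k; the five
    terms are the partitions of 4. *)
Lemma symmetric_quartic (R : comNzRingType) (f : {mpoly R[4]}) :
  f \is symmetric -> f \is 4.-homog ->
  exists A B C D E : R,
    f = A *: es 1 ^+ 4 + B *: (es 1 ^+ 2 * es 2) + C *: es 2 ^+ 2
        + D *: (es 1 * es 3) + E *: es 4.
Proof.
move=> fsym fhom.
have [p [<- /dhomogP phom]] := sym_fundamental_homog fsym fhom.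
rewrite [in X in X \mPo _](mpolyE p) raddf_sum /= big_seq.
apply: (big_ind (fun q => exists A B C D E : R,
    q = A *: es 1 ^+ 4 + B *: (es 1 ^+ 2 * es 2) + C *: es 2 ^+ 2
        + D *: (es 1 * es 3) + E *: es 4)).
- by exists 0, 0, 0, 0, 0; rewrite !scale0r !addr0.
- move=> _ _ [A [B [C [D [E ->]]]]] [A' [B' [C' [D' [E' ->]]]]].
  exists (A + A'), (B + B'), (C + C'), (D + D'), (E + E').
  rewrite -!mul_mpolyC !mpolyCD; ring.
move=> m /phom; rewrite /= /mnmwgt comp_mpolyZ comp_mpolyX.
set S := (S in _ -> S); rewrite !big_ord_recr !big_ord0 {}/S /=.
rewrite !big_ord_recr big_ord0 /= !tnth_mktuple /= mul1r.
move: (p@_m) (m _) (m _) (m _) (m _) => a m3 m2 m1 m0 wm.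
(* The exponents of e_1, e_2, e_3, e_4 are m0, m1, m2, m3; the equation
   m0 + 2 m1 + 3 m2 + 4 m3 = 4 leaves five cases. *)
case: m3 m2 m1 wm => [|[|?]] [|[|?]] [|[|[|?]]] wm; try lia.
- have ->: m0 = 4%N by lia.
  exists a, 0, 0, 0, 0; rewrite -!mul_mpolyC mpolyC0; ring.
- have ->: m0 = 2%N by lia.
  exists 0, a, 0, 0, 0; rewrite -!mul_mpolyC mpolyC0; ring.
- have ->: m0 = 0%N by lia.
  exists 0, 0, a, 0, 0; rewrite -!mul_mpolyC mpolyC0; ring.
- have ->: m0 = 1%N by lia.
  exists 0, 0, 0, a, 0; rewrite -!mul_mpolyC mpolyC0; ring.
- have ->: m0 = 0%N by lia.
  exists 0, 0, 0, 0, a; rewrite -!mul_mpolyC mpolyC0; ring.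
Qed.

(** * The coordinates t, u, v, w *)

Definition Lt (R : comNzRingType) : {mpoly R[4]} := 'X_i0 + 'X_i1 + 'X_i2 + 'X_i3.
Definition Lu (R : comNzRingType) : {mpoly R[4]} := 'X_i0 + 'X_i1 - 'X_i2 - 'X_i3.
Definition Lv (R : comNzRingType) : {mpoly R[4]} := 'X_i0 - 'X_i1 + 'X_i2 - 'X_i3.
Definition Lw (R : comNzRingType) : {mpoly R[4]} := 'X_i0 - 'X_i1 - 'X_i2 + 'X_i3.

Arguments Lt {R}.
Arguments Lu {R}.
Arguments Lv {R}.
Arguments Lw {R}.

(** The point with prescribed coordinates: the matrix of the change of
    coordinates is symmetric with square 4. *)
Definition point (R : unitRingType) (t u v w : R) : 'I_4 -> R :=
  fun i => 4^-1 * nth 0 [:: t + u + v + w; t + u - v - w;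
                           t - u + v - w; t - u - v + w] i.

Lemma meval_point (R : realFieldType) (t u v w : R) :
  [/\ Lt.@[point t u v w] = t, Lu.@[point t u v w] = u,
      Lv.@[point t u v w] = v & Lw.@[point t u v w] = w].
Proof.
by split; rewrite !(mevalD, mevalN, mevalXU) /point /=; field.
Qed.

(** The condition f(1,1,1,1) = 0 is the vanishing of the coefficient of t^4;
    the four remaining coefficients are obtained by expanding e_1,..,e_4 in
    t, u, v, w. The term in c is arranged to vanish on u = v = w. *)
Lemma symmetric_quartic_coordinates (R : realFieldType) (f : {mpoly R[4]}) :
  f \is symmetric -> f \is 4.-homog -> f.@[fun=> 1] = 0 ->
  exists a b c e : R,
    f = a *: (Lt ^+ 2 * (Lu ^+ 2 + Lv ^+ 2 + Lw ^+ 2))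
        + b *: (Lt * Lu * Lv * Lw)
        + e *: (Lu ^+ 2 * Lv ^+ 2 + Lu ^+ 2 * Lw ^+ 2 + Lv ^+ 2 * Lw ^+ 2)
        + c *: ((Lv ^+ 2 - Lw ^+ 2) ^+ 2 + (Lu ^+ 2 - Lw ^+ 2) ^+ 2
                + (Lu ^+ 2 - Lv ^+ 2) ^+ 2).
Proof.
move=> fsym fhom.
have [A [B [C [D [E ->]]]]] := symmetric_quartic fsym fhom.
have [-> -> -> ->] := mesym4E R.
rewrite !(mevalD, mevalZ, mevalM, rmorphXn, mevalXU) /= => f1_eq0.
have {f1_eq0}->: E = - (256 * A + 96 * B + 36 * C + 16 * D) by lra.
(* 32 is a common denominator of the new coefficients. *)
have div32 x : exists y : R, x = 32 * y by exists (x / 32); field.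
have [[{}A ->] [{}B ->]] := (div32 A, div32 B).
have [[{}C ->] [{}D ->]] := (div32 C, div32 D).
exists (2 * (32 * A + 10 * B + 3 * C + D)),
  (- 4 * (64 * A + 24 * B + 9 * C + 3 * D)),
  (- (16 * A + 6 * B + 2 * C + D)), (2 * (16 * A + 6 * B + 3 * C + D)).
rewrite /Lt /Lu /Lv /Lw -!mul_mpolyC.
ring.
Qed.

(** * Nonnegative forms are sums of three blocks *)

(** q(tu,vw) + ka^2 (v^2-w^2)^2, for the binary quadratic form
    q(X,Y) = (al X + be Y)^2 + (ga Y)^2. *)
Definition block (R : comNzRingType) (al be ga ka : R) (t u v w : {mpoly R[4]}) :=
  (al *: (t * u) + be *: (v * w)) ^+ 2 + (ga *: (v * w)) ^+ 2
  + (ka *: (v ^+ 2 - w ^+ 2)) ^+ 2.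

Lemma meval_block (R : comNzRingType) (al be ga ka : R)
    (t u v w : {mpoly R[4]}) x :
  (block al be ga ka t u v w).@[x] =
  (al * (t.@[x] * u.@[x]) + be * (v.@[x] * w.@[x])) ^+ 2
  + (ga * (v.@[x] * w.@[x])) ^+ 2 + (ka * (v.@[x] ^+ 2 - w.@[x] ^+ 2)) ^+ 2.
Proof. by rewrite /block !(mevalD, mevalN, mevalZ, mevalM, rmorphXn). Qed.

(** Completing the square: the discriminant is nonpositive, and when the leading
    coefficient vanishes this leaves only the constant c >= 0. *)
Lemma nonneg_quadratic_sos (R : rcfType) (a b c : R) :
  (forall x, 0 <= a * x ^+ 2 + b * x + c) ->
  exists al be ga : R,
    [/\ al ^+ 2 = a, 2 * al * be = b & be ^+ 2 + ga ^+ 2 = c].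
Proof.
move=> q_ge0.
have disc : b ^+ 2 - 4 * a * c <= 0.
  have sz : (size (Poly [:: c; b; a]) <= 3)%N by rewrite size_Poly.
  have := deg_le2_poly_ge0 sz; rewrite !coef_Poly /=; apply=> x.
  by have := q_ge0 x; rewrite /= !horner_cons horner0; congr (0 <= _); ring.
have c_ge0 : 0 <= c by have := q_ge0 0; rewrite expr0n mulr0 mulr0 !add0r.
have q1 := q_ge0 1; have qN1 := q_ge0 (-1).
have b2_ge0 := sqr_ge0 b.
have a_ge0 : 0 <= a.
  rewrite leNgt; apply/negP => a_lt0.
  have c_gt0 : 0 < c by lra.
  have : a * c < 0 by rewrite nmulr_rlt0.
  lra.
have [a_gt0|a_le0] := ltP 0 a.
  have s_neq0 : Num.sqrt a != 0 by rewrite gt_eqF ?sqrtr_gt0.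
  have be2 : (b / (2 * Num.sqrt a)) ^+ 2 = b ^+ 2 / (4 * a).
    by rewrite expr_div_n exprMn sqr_sqrtr //; congr (_ / (_ * _)); ring.
  exists (Num.sqrt a), (b / (2 * Num.sqrt a)), (Num.sqrt (c - b ^+ 2 / (4 * a))).
  split; first by rewrite sqr_sqrtr.
    by field.
  rewrite be2 sqr_sqrtr ?subr_ge0 ?ler_pdivrMr; lra.
have a0 : a = 0 by lra.
exists 0, 0, (Num.sqrt c); rewrite sqr_sqrtr //.
have /eqP : b ^+ 2 = 0 by rewrite a0 in disc; lra.
by rewrite sqrf_eq0 => /eqP ->; split; rewrite ?a0; ring.
Qed.

(** Nonnegativity is needed only at (0,1,0,0) and on the line u = v = w = 1: it
    makes the coefficient c a square and the binary form q a sum of squares,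
    and each of the three blocks receives its own pair (tu, vw). *)
Lemma P44s0_blocks (R : realType) (f : {mpoly R[4]}) : P44s0 f ->
  exists al be ga ka : R,
    f = block al be ga ka Lt Lu Lv Lw + block al be ga ka Lt Lv Lu Lw
        + block al be ga ka Lt Lw Lu Lv.
Proof.
move=> [[fhom f_ge0] fsym f1_eq0].
have [a [b [c [e fE]]]] := symmetric_quartic_coordinates fsym fhom f1_eq0.
have fpt t u v w :
    0 <= a * (t ^+ 2 * (u ^+ 2 + v ^+ 2 + w ^+ 2)) + b * (t * u * v * w)
    + e * (u ^+ 2 * v ^+ 2 + u ^+ 2 * w ^+ 2 + v ^+ 2 * w ^+ 2)
    + c * ((v ^+ 2 - w ^+ 2) ^+ 2 + (u ^+ 2 - w ^+ 2) ^+ 2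
           + (u ^+ 2 - v ^+ 2) ^+ 2).
  have := f_ge0 (point t u v w); rewrite fE; have := meval_point t u v w.
  (* Generalized, so that evaluation does not expand them into monomials. *)
  move: Lt Lu Lv Lw (point _ _ _ _) => T U V W x [tE uE vE wE].
  by rewrite !(mevalD, mevalN, mevalZ, mevalM, rmorphXn) /= tE uE vE wE.
have [|al [be [ga [aE bE eE]]]] :=
  nonneg_quadratic_sos (a := a) (b := b / 3) (c := e).
  (* On u = v = w = 1 the form is 3 (a t^2 + (b/3) t + e). *)
  by move=> x; have := fpt x 1 1 1; lra.
have c_ge0 : 0 <= c by have := fpt 0 1 0 0; lra.
exists al, be, ga, (Num.sqrt c).
have {}bE : b = 6 * al * be by lra.
rewrite fE -aE bE -eE -{1}(sqr_sqrtr c_ge0) /block -!mul_mpolyC.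
ring.
Qed.

(** * Sums of squares *)

Lemma Sigma44D (R : realType) (f g : {mpoly R[4]}) :
  Sigma44 f -> Sigma44 g -> Sigma44 (f + g).
Proof.
move=> [r [p [phom ->]]] [s [q [qhom ->]]].
exists (r + s)%N, (fun i => match split i with inl j => p j | inr j => q j end).
split=> [i|]; first by case: (split i).
rewrite big_split_ord /=; congr (_ + _); apply: eq_bigr => i _.
  by rewrite -/(unsplit (inl i)) unsplitK.
by rewrite -/(unsplit (inr i)) unsplitK.
Qed.

Lemma Sigma44_sqr (R : realType) (f : {mpoly R[4]}) :
  f \is 2.-homog -> Sigma44 (f ^+ 2).
Proof. by move=> fhom; exists 1%N, (fun=> f); rewrite big_ord1. Qed.

Lemma Sigma44_P44 (R : realType) (f : {mpoly R[4]}) : Sigma44 f -> P44 f.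
Proof.
move=> [r [g [ghom ->]]]; split.
  by apply: rpred_sum => i _; apply: (@dhomogMn _ _ _ 2 _ 2).
by move=> x; rewrite raddf_sum sumr_ge0 //= => i _; rewrite rmorphXn sqr_ge0.
Qed.

Lemma Sigma44_block (R : realType) (al be ga ka : R) (t u v w : {mpoly R[4]}) :
  t \is 1.-homog -> u \is 1.-homog -> v \is 1.-homog -> w \is 1.-homog ->
  Sigma44 (block al be ga ka t u v w).
Proof.
move=> th uh vh wh.
have M (p q : {mpoly R[4]}) :
    p \is 1.-homog -> q \is 1.-homog -> p * q \is 2.-homog.
  exact: dhomogM.
by apply: Sigma44D; first apply: Sigma44D; apply: Sigma44_sqr;
  rewrite ?rpredD ?rpredN ?rpredZ ?rpredB ?expr2 ?M.
Qed.

Lemma coordinates_homog (R : comNzRingType) :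
  [/\ (Lt : {mpoly R[4]}) \is 1.-homog, (Lu : {mpoly R[4]}) \is 1.-homog,
      (Lv : {mpoly R[4]}) \is 1.-homog
    & (Lw : {mpoly R[4]}) \is 1.-homog].
Proof.
have X i : 'X_i \is 1.-homog :> bool by rewrite dhomogX; apply/eqP/mdeg1.
by split; rewrite ?rpredD ?rpredN ?X.
Qed.

(** * Extremality *)

(** The exchange of u and v fixes f but swaps its first two blocks, so a first
    block proportional to f would have to coincide with the second one. *)
Lemma P44s0_not_extremal (R : realType) (f : {mpoly R[4]}) :
  P44s0 f -> ~ extremal (@P44 R) f.
Proof.
move=> fP [_ f_neq0 fext].
have [al [be [ga [ka fE]]]] := P44s0_blocks fP.
have [ht hu hv hw] := coordinates_homog R.
have [] := fext (block al be ga ka Lt Lu Lv Lw)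
  (block al be ga ka Lt Lv Lu Lw + block al be ga ka Lt Lw Lu Lv).
- exact/Sigma44_P44/Sigma44_block.
- by apply/Sigma44_P44/Sigma44D; apply: Sigma44_block.
- by rewrite addrA.
move=> [x bE] _.
have evD (p q r : {mpoly R[4]}) y :
    (p + q + r).@[y] = p.@[y] + q.@[y] + r.@[y].
  by rewrite !mevalD.
have first_block_exch t u v w :
    (al * (t * u) + be * (v * w)) ^+ 2 + (ga * (v * w)) ^+ 2
    + (ka * (v ^+ 2 - w ^+ 2)) ^+ 2 =
    (al * (t * v) + be * (u * w)) ^+ 2 + (ga * (u * w)) ^+ 2
    + (ka * (u ^+ 2 - w ^+ 2)) ^+ 2.
  have ev t' u' v' w' : (block al be ga ka Lt Lu Lv Lw).@[point t' u' v' w'] =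
     (al * (t' * u') + be * (v' * w')) ^+ 2 + (ga * (v' * w')) ^+ 2
      + (ka * (v' ^+ 2 - w' ^+ 2)) ^+ 2.
    rewrite meval_block.
    by have [-> -> -> ->] := meval_point t' u' v' w'.
  rewrite -ev -ev bE !mevalZ; congr (_ * _).
  rewrite fE evD [in RHS]evD !meval_block.
  have [-> -> -> ->] := meval_point t u v w.
  have [-> -> -> ->] := meval_point t v u w.
  ring.
have ka0 : ka = 0 by have := first_block_exch 0 1 0 0; nra.
have al0 : al = 0 by have := first_block_exch 1 1 0 0; rewrite ka0; nra.
have [be0 ga0] : be = 0 /\ ga = 0.
  by have := first_block_exch 0 0 1 1; rewrite ka0; split; nra.
move/eqP: f_neq0; apply.
by rewrite fE /block al0 be0 ga0 ka0 !scale0r !addr0 expr0n !addr0.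
Qed.

Theorem corollary1p3 (R : realType) :
  @P44s0 R `<=` @Sigma44 R /\
  extremal (@P44s0 R) `&` extremal (@P44 R) = set0.
Proof.
split=> [f fP|].
  have [al [be [ga [ka ->]]]] := P44s0_blocks fP.
  have [ht hu hv hw] := coordinates_homog R.
  by apply: Sigma44D; first apply: Sigma44D; apply: Sigma44_block.
by rewrite -subset0 => f [[fP _ _]] /(P44s0_not_extremal fP).
Qed.
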